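(* Let $h\ge2$ and $\kappa\ge1$ be integers, and let $f(\delta)=1+a\delta$ with a parameter $a\ge0$. On the class of all instances with capacity $C\ge h\cdot n_{\max}$, where $n_{\max}$ is the maximum number of instances demanded by a job, and with job lengths in $[1,\kappa]$, the competitive ratio of the greedy mechanism $\Gamma_G$ with the linear priority function $f$ is at least $$\frac{h}{h-1}\cdot\left(\sqrt{2\kappa(\kappa+1)}+\frac32\kappa+\frac12\right)+1 .$$
   Context: Setting. A cloud provider has $C\in\mathbb{N}$ identical instances at every time $t\in[0,\infty)$. A job sequence $\theta$ is a finite list of jobs $\theta_i=(r_i,d_i,n_i,l_i,v_i)$: release time $r_i\ge0$, deadline $d_i$, required number of instances $n_i$ (positive integer, $n_i\le n_{\max}\le C$), length $l_i\in[1,\kappa]$ ($\kappa$ a positive integer), value $v_i>0$. Nothing is known about job $i$ before time $r_i$. An allocation is feasible if at every time the total number of allocated instances is at most $C$. Job $i$ is completed if it receives at least $n_i$ instances continuously for $l_i$ time units between $r_i$ and $d_i$; an interrupted job loses all its progress but may be restarted from scratch. The social welfare of an allocation is the sum of the values of the completed jobs. $OPT(\theta)$ is the maximum social welfare of a feasible allocation computed offline with full knowledge of $\theta$; $W(M,\theta)$ is the social welfare obtained by the online mechanism $M$ on $\theta$ (with truthful reports). Competitiveness. $M$ is $c$-competitive on a class of instances if no instance in the class satisfies $c\cdot W(M,\theta)<OPT(\theta)$. The competitive ratio of $M$ on the class is the least such $c$ ($\infty$ if there is none). Mechanism $\Gamma_G$ with priority function $f$ ($f:[0,1]\to\mathbb{R}$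 non-decreasing, $f(0)=1$). At time $t$ let $\delta_i\in[0,1]$ be the fraction of $l_i$ for which job $i$ has been continuously processed up to $t$ in its current uninterrupted run ($\delta_i=0$ if it is not running). Job $i$ is feasible at $t$ if $r_i\le t$, $d_i-t\ge(1-\delta_i)l_i$, and it has not been completed. A time is critical if a job is released or a running job is completed at that time. At every critical time $t$, in increasing order: let $J_F$ be the set of feasible jobs; set $v_i'=v_if(\delta_i)$ and $\rho_i'=\frac{v_i}{n_i}f(\delta_i)$; number the jobs of $J_F$ by descending $\rho_i'$ (ties broken by an arbitrary fixed rule). If the total demand $\sum n_i$ of all jobs in $J_F$ is at most $C$, run all of $J_F$. Otherwise let $k$ be the smallest index with $n_1+\dots+n_k>C$; if $\sum_{i=1}^{k-1}v_i'\ge v_k'$ run jobs $1,\dots,k-1$, else run only job $k$. The chosen jobs run (job $i$ on $n_i$ instances) until the next critical time; running jobs that are not chosen are interrupted. (Each completed job pays its critical value, the minimum reported value for which it would be completed; payments do not affect social welfare.) *)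

(* Defs.v *)
From HB Require Import structures.
From mathcomp Require Import all_boot all_order all_algebra.
From mathcomp Require Import all_classical all_reals ereal.

Set Implicit Arguments.
Unset Strict Implicit.
Unset Printing Implicit Defensive.

Import Order.TTheory GRing.Theory Num.Theory.

Local Open Scope classical_set_scope.
Local Open Scope ring_scope.

Record job (R : realType) := Job {
  release : R;
  deadline : R;
  demand : nat;
  len : R;
  value : R }.

Record instance (R : realType) := Instance {
  capacity : nat;
  njobs : nat;
  job_of : 'I_njobs -> job R }.

Section Instances.
Variables (R : realType) (I : instance R).
Local Notation J := (@job_of R I).

Definition n_max : nat := (\max_(i < njobs I) demand (J i))%N.

Definition valid (kappa : nat) : Prop := forall i,
  [/\ 0 <= release (J i),
      (0 < demand (J i) <= capacity I)%N,
      1 <= len (J i) <= kappa%:R &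
      0 < value (J i)].

Definition total_value (S : {set 'I_(njobs I)}) : R :=
  \sum_(i in S) value (J i).

(* [A t i] is the number of instances that job [i] holds at time [t]. *)
Definition allocation := R -> 'I_(njobs I) -> nat.

Definition feasible_allocation (A : allocation) : Prop :=
  forall t, 0 <= t -> (\sum_(i < njobs I) A t i <= capacity I)%N.

(* Runs occupy half-open time intervals, so that instances released by one job
   at time [t] can serve another job from time [t] on. *)
Definition completes (A : allocation) (i : 'I_(njobs I)) : Prop :=
  exists s, [/\ release (J i) <= s, s + len (J i) <= deadline (J i) &
    forall t, s <= t < s + len (J i) -> (demand (J i) <= A t i)%N].

Definition social_welfare (A : allocation) : R :=
  total_value [set i | `[< completes A i >]]%SET.

(* Only finitely many values are attained, hence this [sup] is a maximum. *)
Definition OPT : R :=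
  sup [set social_welfare A | A in [set A | feasible_allocation A]].

End Instances.

Definition large_capacity (R : realType) (h kappa : nat) : set (instance R) :=
  [set I | valid I kappa /\ (h * n_max I <= capacity I)%N].

Section Competitiveness.
Variables (R : realType) (cls : set (instance R)) (W : instance R -> R).

Definition competitive (c : R) : Prop :=
  forall I, cls I -> ~ (c * W I < OPT I).

Definition competitive_ratio : \bar R :=
  ereal_inf [set c%:E | c in [set c | competitive c]].

End Competitiveness.

(* A tie-breaking rule is a total order on triples made of the position of a
   job in the sequence (which separates jobs with equal parameters), its
   parameters and its current progress. *)
Definition tie_rule (R : realType) := rel (nat * job R * R).

Definition is_tie_rule (R : realType) (tie : tie_rule R) : Prop :=
  [/\ total tie, transitive tie & antisymmetric tie].

Section Greedy.
Variables (R : realType) (f : R -> R) (tie : tie_rule R) (I : instance R).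
Local Notation J := (@job_of R I).

(* Situation right after the decision taken at time [now]: [since i] is the
   starting time of the current uninterrupted run of job [i], if it is running. *)
Record state := State {
  now : R;
  since : {ffun 'I_(njobs I) -> option R};
  finished : {set 'I_(njobs I)} }.

Section Decision.
Variables (t : R) (st : {ffun 'I_(njobs I) -> option R}).
Variable (fin : {set 'I_(njobs I)}).

Definition progress (i : 'I_(njobs I)) : R :=
  if st i is Some u then (t - u) / len (J i) else 0.

Definition feasible_jobs : {set 'I_(njobs I)} :=
  [set i | [&& release (J i) <= t,
               (1 - progress i) * len (J i) <= deadline (J i) - t &
               i \notin fin]]%SET.

Definition priority_value (i : 'I_(njobs I)) : R :=
  value (J i) * f (progress i).

Definition priority_density (i : 'I_(njobs I)) : R :=
  value (J i) / (demand (J i))%:R * f (progress i).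

Definition ranks_before (i j : 'I_(njobs I)) : bool :=
  (priority_density j < priority_density i) ||
  ((priority_density i == priority_density j) &&
   tie (val i, J i, progress i) (val j, J j, progress j)).

Definition ranking : seq 'I_(njobs I) :=
  sort ranks_before (enum feasible_jobs).

Definition total_demand (q : seq 'I_(njobs I)) : nat :=
  (\sum_(i <- q) demand (J i))%N.

(* The length of the longest prefix of the ranking that fits; it is
   [size ranking] if all feasible jobs fit, and otherwise the 0-based position
   of the first job that overflows the capacity. *)
Definition fitting : nat :=
  find (fun p => capacity I < total_demand (take p.+1 ranking))%N
       (iota 0 (size ranking)).

Definition chosen : seq 'I_(njobs I) :=
  if drop fitting ranking is j :: _ then
    if priority_value j <= \sum_(i <- take fitting ranking) priority_value i
    then take fitting ranking else [:: j]
  else ranking.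

Definition decide : state :=
  State t
    [ffun i => if i \in chosen then (if st i is Some u then Some u else Some t)
               else None]
    fin.

End Decision.

Definition event_times (s : state) : seq R :=
  [seq release (J i) | i <- enum 'I_(njobs I) & now s < release (J i)] ++
  pmap (fun i => omap (fun u => u + len (J i)) (since s i)) (enum 'I_(njobs I)).

Definition next_critical (s : state) : option R :=
  if event_times s is t :: ts then Some (foldr Num.min t ts) else None.

Definition finished_at (t : R) (s : state) : {set 'I_(njobs I)} :=
  (finished s :|:
   [set i | if since s i is Some u then u + len (J i) <= t else false])%SET.

Definition step (s : state) : state :=
  if next_critical s is Some t then decide t (since s) (finished_at t s)
  else s.

(* Time 0 always counts as critical, which has no effect if no job is released
   then.  Each later critical time is a release time or completes a job, so
   [2 * njobs I] steps exhaust them. *)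
Definition greedy_run : state :=
  iter (2 * njobs I)%N step (decide 0 [ffun=> None] finset.set0).

Definition greedy_welfare : R := total_value (finished greedy_run).

End Greedy.

Definition linear_priority (R : realType) (a : R) : R -> R :=
  fun delta => 1 + a * delta.

(* Main.v *)
Require Import Defs.
From HB Require Import structures.
From mathcomp Require Import all_boot all_order all_algebra.
From mathcomp Require Import all_classical all_reals ereal.
From mathcomp Require Import ring lra.

Set Implicit Arguments.
Unset Strict Implicit.
Unset Printing Implicit Defensive.

Import Order.TTheory GRing.Theory Num.Theory.

Local Open Scope ring_scope.

(** The adversary releases chains 0, ..., M of jobs of length kappa.  Chain i+1
    arrives just before chain i completes and is slightly more than 1 + a times
    as dense, so it interrupts chain i; only chain M is ever completed.  A chain
    consists of h - 1 jobs of demand n and one of demand 1, so that it occupies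
    only (h - 1) n + 1 of the C = h n instances but leaves no room for one more
    job of demand n.  While chain i runs, kappa groups of tight unit-length
    fillers, h jobs of demand n each, are released one time unit apart, each
    with a density just below the current priority of the chain, so that greedy
    rejects all of them.  The offline schedule runs all fillers and then
    chain M.  As n, M -> oo and u -> 1, the ratio tends to
    h / (h - 1) * (kappa + a (kappa + 1) / 2) * (1 + 1 / a) + 1,
    and AM-GM in a gives the bound. *)

(** * The greedy choice at a single decision *)

Lemma pairwise_filter_split (T : eqType) (r : rel T) (p : pred T) (s : seq T) :
  {in s &, forall x y, p x -> ~~ p y -> ~~ r y x} -> pairwise r s ->
  s = [seq x <- s | p x] ++ [seq x <- s | ~~ p x].
Proof.
elim: s => [//|x s IHs] sep /= /andP[/allP rx rs].
have {}IHs : s = [seq y <- s | p y] ++ [seq y <- s | ~~ p y].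
  by apply: IHs rs => y z ys zs; apply: sep; rewrite inE ?ys ?zs orbT.
case: ifP => px /=; first by rewrite {1}IHs.
have np y : y \in s -> p y = false.
  move=> ys; apply: contraTF (rx _ ys) => py.
  by apply: sep; rewrite ?px // inE ?eqxx ?ys ?orbT.
rewrite (eq_in_filter (a2 := pred0)) => [|y /np //].
rewrite filter_pred0 /=; congr cons.
by apply/esym/all_filterP/allP => y /np->.
Qed.

Section GreedyChoice.
Variables (R : realType) (f : R -> R) (tie : tie_rule R) (I : instance R).
Hypothesis tieP : is_tie_rule tie.
Variables (t : R) (st : {ffun 'I_(njobs I) -> option R}).
Variable (fin : {set 'I_(njobs I)}).

Local Notation density := (priority_density f t st).
Local Notation before := (ranks_before f tie t st).
Local Notation dem k := (demand (@job_of R I k)).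

Lemma ranks_before_total : total before.
Proof.
have [tie_total _ _] := tieP; move=> i j; rewrite /ranks_before.
by case: ltgtP => //= _; apply: tie_total.
Qed.

Lemma ranks_before_trans : transitive before.
Proof.
have [_ tie_trans _] := tieP; move=> j i k; rewrite /ranks_before.
move=> /orP[ij|/andP[/eqP ij tij]] /orP[jk|/andP[/eqP jk tjk]].
- by rewrite (lt_trans jk ij).
- by rewrite -jk ij.
- by rewrite ij jk.
- by rewrite ij jk eqxx (tie_trans _ _ _ tij tjk) orbT.
Qed.

Lemma ranks_before_density i j : before i j -> density j <= density i.
Proof. by case/orP=> [/ltW//|/andP[/eqP->]]. Qed.

(** Identifies the chosen set without computing the ranking: [G] is an initial segment of it, so
    only the first job after [G] decides whether the mechanism stops there and keeps [G]. An
    outsider with a strictly denser outsider is never that first job, which is why it is exempt from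
    the overflow and value conditions. *)
Lemma chosen_dominating (G : {set 'I_(njobs I)}) :
  G \subset feasible_jobs t st fin ->
  (\sum_(k in G) dem k <= capacity I)%N ->
  (forall g x, g \in G -> x \in feasible_jobs t st fin -> x \notin G ->
     density x < density g) ->
  (forall x, x \in feasible_jobs t st fin -> x \notin G ->
     ((capacity I < \sum_(k in G) dem k + dem x)%N /\
      priority_value f t st x <= \sum_(k in G) priority_value f t st k) \/
     exists x', [/\ x' \in feasible_jobs t st fin, x' \notin G &
       density x < density x']) ->
  chosen f tie t st fin =i G.
Proof.
set F := feasible_jobs t st fin => GF Gcap Gtop next.
pose s := ranking f tie t st fin.
have s_pairwise : pairwise before s.
  rewrite -sorted_pairwise; last exact: ranks_before_trans.
  exact/sort_sorted/ranks_before_total.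
have mem_s k : (k \in s) = (k \in F) by rewrite mem_sort mem_enum.
have s_uniq : uniq s by rewrite sort_uniq enum_uniq.
pose gs := [seq x <- s | x \in G]; pose xs := [seq x <- s | x \notin G].
have s_split : s = gs ++ xs.
  apply: (pairwise_filter_split _ s_pairwise) => x y _ ys xG yG.
  apply/negP => /ranks_before_density.
  by rewrite leNgt Gtop // -mem_s.
have gsG : gs =i G.
  by move=> k; rewrite mem_filter mem_s; apply: andb_idr; exact: (fintype.subsetP GF).
have gs_uniq : uniq gs by rewrite filter_uniq.
have sumG (V : nmodType) (w : 'I_(njobs I) -> V) :
    \sum_(k <- gs) w k = \sum_(k in G) w k.
  by rewrite big_uniq //; apply: eq_bigl.
have demG : total_demand gs = (\sum_(k in G) dem k)%N.
  by rewrite /total_demand big_uniq //; apply: eq_bigl.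
have small p : (p <= size gs)%N -> (total_demand (take p s) <= capacity I)%N.
  move=> p_le; rewrite s_split take_cat; case: ltnP => [p_lt|]; last first.
    move=> p_ge; have -> : (p - size gs = 0)%N by apply/eqP; rewrite subn_eq0.
    by rewrite take0 cats0 demG.
  apply: leq_trans Gcap; rewrite -demG /total_demand -{2}(cat_take_drop p gs).
  by rewrite big_cat leq_addr.
(* With no outsider all feasible jobs fit; otherwise [x0] is the outsider ranked first, and the
   exemption cannot apply to it. *)
case xsE : xs => [|x0 xs'].
  have sE : s = gs by rewrite s_split xsE cats0.
  have fit : fitting f tie t st fin = size s.
    rewrite /fitting -/s hasNfind ?size_iota //; apply/hasPn => p.
    by rewrite mem_iota add0n /= -leqNgt => p_lt; rewrite small // -sE.
  by move=> k; rewrite /chosen -/s fit drop_size sE gsG.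
have x0s : x0 \in xs by rewrite xsE mem_head.
have [x0F x0G] : x0 \in F /\ x0 \notin G.
  by move: x0s; rewrite mem_filter mem_s /= => /andP[].
have [[over val_le]|[x' [x'F x'G]]] := next _ x0F x0G; last first.
  have x'xs : x' \in xs by rewrite mem_filter mem_s x'F andbT.
  have : pairwise before xs.
    by move: s_pairwise; rewrite s_split pairwise_cat => /and3P[].
  rewrite xsE /= => /andP[/allP x0_before _].
  move: x'xs; rewrite xsE inE => /orP[/eqP->|/x0_before/ranks_before_density].
    by rewrite ltxx.
  by rewrite leNgt => /negbTE->.
have sz : size s = (size gs + (size xs').+1)%N.
  by rewrite s_split size_cat xsE.
have fit : fitting f tie t st fin = size gs.
  rewrite /fitting -/s sz iotaD find_cat ifF; last first.
    apply/hasPn => p; rewrite mem_iota add0n /= -leqNgt => p_lt.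
    exact: small.
  rewrite size_iota /= add0n s_split xsE -cat_rcons take_size_cat ?size_rcons //.
  by rewrite /total_demand -cats1 big_cat big_seq1 -/(total_demand gs) demG over addn0.
move=> k; rewrite /chosen -/s fit s_split drop_size_cat // take_size_cat // xsE.
by rewrite sumG val_le gsG.
Qed.

Lemma since_decide k :
  since (decide f tie t st fin) k =
  if k \in chosen f tie t st fin
  then if st k is Some u then Some u else Some t else None.
Proof. by rewrite ffunE. Qed.

End GreedyChoice.

(** * Bounding [OPT] from below and locating critical times *)

Lemma OPT_ge_schedule (R : realType) (I : instance R) (kappa : nat)
    (S : {set 'I_(njobs I)}) (start : 'I_(njobs I) -> R) :
  valid I kappa ->
  (forall k, k \in S -> release (job_of k) <= start k /\
     start k + len (job_of k) <= deadline (job_of k)) ->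
  (forall t, (\sum_(k in S | (start k <= t < start k + len (job_of k))%R)
     demand (job_of k) <= capacity I)%N) ->
  total_value S <= OPT I.
Proof.
move=> Ivalid S_in S_cap.
have val_ge0 (k : 'I_(njobs I)) : 0 <= value (job_of k) by have [_ _ _ /ltW] := Ivalid k.
have mono (A B : {set 'I_(njobs I)}) : A \subset B -> total_value A <= total_value B.
  move=> AB; rewrite /total_value [leRHS](big_setID A) /= (finset.setIidPr AB).
  by rewrite lerDl sumr_ge0.
pose A : allocation I := fun t k =>
  if (k \in S) && (start k <= t < start k + len (job_of k))
  then demand (job_of k) else 0%N.
apply: (@le_trans _ _ (social_welfare A)).
  apply/mono/fintype.subsetP => k kS; rewrite inE; apply/asboolP.
  have [rel dl] := S_in k kS; exists (start k); split=> // t t_in.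
  by rewrite /A kS t_in.
apply: ub_le_sup; last first.
  exists A => // t _; apply: leq_trans (S_cap t).
  by rewrite -big_mkcond.
(* A [sup] dominates its members only for a set bounded above; the value of all jobs is such a
   bound. *)
exists (total_value [set: 'I_(njobs I)]%SET) => _ [B _ <-].
exact/mono/finset.subsetT.
Qed.

Lemma next_critical_some (R : realType) (I : instance R) (s : state I) (t : R) :
  next_critical s = Some t ->
  [/\ forall k : 'I_(njobs I), now s < release (job_of k) -> t <= release (job_of k),
      forall (k : 'I_(njobs I)) v, since s k = Some v -> t <= v + len (job_of k) &
      (exists k : 'I_(njobs I), t = release (job_of k) /\ now s < release (job_of k)) \/
      (exists (k : 'I_(njobs I)) v, since s k = Some v /\ t = v + len (job_of k))].
Proof.
have min_mem (x : R) xs : foldr Num.min x xs \in x :: xs.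
  elim: xs => [|y xs IHxs] /=; first by rewrite mem_head.
  by case: leP => _; move: IHxs; rewrite !inE ?eqxx ?orbT // => /orP[]->; rewrite ?orbT.
have min_le (x : R) xs y : y \in x :: xs -> foldr Num.min x xs <= y.
  elim: xs => [|z xs IHxs] /=; first by rewrite inE => /eqP->.
  rewrite !inE ge_min orbCA => /orP[/eqP->|]; first by rewrite lexx.
  by move=> /IHxs->; rewrite orbT.
rewrite /next_critical; case E: (event_times s) => [//|x xs] [<-].
have mem_rel (k : 'I_(njobs I)) : now s < release (job_of k) -> release (job_of k) \in x :: xs.
  move=> k_new; rewrite -E mem_cat; apply/orP; left.
  by apply/mapP; exists k; rewrite // mem_filter k_new mem_enum.
have mem_end (k : 'I_(njobs I)) v : since s k = Some v -> v + len (job_of k) \in x :: xs.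
  move=> sk; rewrite -E mem_cat mem_pmap; apply/orP; right.
  by apply/mapP; exists k; rewrite ?mem_enum // sk.
split=> [k /mem_rel/min_le//|k v /mem_end/min_le//|].
have := min_mem x xs; rewrite -[in X in _ \in X]E mem_cat => /orP[/mapP[k]|].
  by rewrite mem_filter => /andP[k_new _] ->; left; exists k.
rewrite mem_pmap => /mapP[k _]; case sk: (since s k) => [v|//] [->].
by right; exists k, v.
Qed.

(** * The adversarial instance *)

Section Adversary.
Variables (R : realType) (h kappa M n : nat) (a u : R).
Hypotheses (h_gt1 : (1 < h)%N) (kappa_gt0 : (0 < kappa)%N) (n_gt0 : (0 < n)%N).
Hypotheses (a_ge0 : 0 <= a) (u_gt0 : 0 < u) (u_lt1 : u < 1).

(* Makes even the demand-1 job of a new chain, whose density is scaled down by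
   u, denser than the old chain at full progress: growth * u > 1 + a. *)
Definition growth : R := (1 + a) / u ^+ 2.
(* Chains are kappa - lag apart and filler groups kappa per chain; since
   (M + 1) * lag < 1 - u, the accumulated drift never moves a filler out of the
   run of its chain. *)
Definition lag : R := (1 - u) / M.+2%:R.
Definition chain_start (i : nat) : R := i%:R * (kappa%:R - lag).
Definition filler_start (i j : nat) : R := i%:R * kappa%:R + j%:R + u.
Definition fillers_end : R := M.+1%:R * kappa%:R + u.

(* Job 0 of a chain has demand 1 and is the least dense one, so that an
   interrupted chain is blocked by its demand-n jobs, which no longer fit, before
   the small job gets a chance to continue.  Only chain M has a loose deadline. *)
Definition chain_job (i r : nat) : job R :=
  Job (chain_start i) ((if (i < M)%N then chain_start i else fillers_end) + kappa%:R)
    (if r == 0%N then 1 else n) kappa%:R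
    (growth ^+ i * (if r == 0%N then u else n%:R)).

(** The deadline is tight: a filler starts on release or never. One factor [u] puts its density
    below that of the demand-1 chain job; the other compensates for counting [j + 1] where the chain
    has only progressed by about [j + u]. *)
Definition filler_job (i j : nat) : job R :=
  Job (filler_start i j) (filler_start i j + 1) n 1
    (growth ^+ i * u ^+ 2 * (1 + a * (j.+1%:R / kappa%:R)) * n%:R).

Definition adv_index : finType := ('I_M.+1 * 'I_h + 'I_M.+1 * 'I_kappa * 'I_h)%type.

Definition adv_job (x : adv_index) : job R :=
  match x with
  | inl (i, r) => chain_job i r
  | inr (i, j, r) => filler_job i j
  end.

Definition adversary : instance R :=
  Instance (h * n) (fun k : 'I_#|adv_index| => adv_job (enum_val k)).

Local Notation index := 'I_(njobs adversary).

(** * Sums over the jobs of a chain *)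

Definition index_of (k : index) : adv_index := enum_val k.

Lemma index_ofK (x : adv_index) : index_of (enum_rank x) = x.
Proof. exact: enum_rankK. Qed.

Lemma job_ofE (k : index) : job_of k = adv_job (index_of k).
Proof. by []. Qed.

Lemma big_index (V : Type) (idx : V) (op : Monoid.com_law idx)
    (P : pred adv_index) (F : adv_index -> V) :
  \big[op/idx]_(k : index | P (index_of k)) F (index_of k) =
  \big[op/idx]_(x | P x) F x.
Proof.
rewrite (reindex index_of) //; exists enum_rank => x _; last exact: enum_rankK.
exact: enum_valK.
Qed.

Definition chain_of (x : adv_index) : option nat :=
  if x is inl (i, _) then Some (val i) else None.

Definition chain (i : nat) : {set index} :=
  [set k | chain_of (index_of k) == Some i]%SET.

Lemma big_chain (V : Type) (idx : V) (op : Monoid.com_law idx)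
    (F : adv_index -> V) (i : 'I_M.+1) :
  \big[op/idx]_(k in chain i) F (index_of k) =
  \big[op/idx]_(r < h) F (inl (i, r)).
Proof.
rewrite (eq_bigl (fun k => chain_of (index_of k) == Some (val i))); last first.
  by move=> k; rewrite inE.
rewrite (big_index _ (fun x => chain_of x == Some (val i))) big_sumType /=.
rewrite [X in op _ X]big_pred0 // Monoid.mulm1.
rewrite (eq_bigl (fun x : 'I_M.+1 * 'I_h => (x.1 == i) && true)); last first.
  by move=> [i' r] /=; rewrite andbT.
rewrite (eq_bigr (fun x : 'I_M.+1 * 'I_h => F (inl (x.1, x.2)))); last by case.
rewrite -(pair_big (pred1 i) xpredT (fun i' r => F (inl (i', r)))) /=.
by rewrite big_pred1_eq.
Qed.

Lemma chain_demand (i : 'I_M.+1) :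
  (\sum_(k in chain i) demand (job_of k) = h.-1 * n + 1)%N.
Proof.
rewrite (big_chain _ (fun x => demand (adv_job x))) /=.
case: (h) h_gt1 => // h' _; rewrite big_ord_recl /= sum_nat_const card_ord.
by rewrite addnC.
Qed.

Lemma chain_total_value (i : 'I_M.+1) :
  total_value (chain i) = growth ^+ i * (h.-1%:R * n%:R + u).
Proof.
rewrite /total_value (big_chain _ (fun x => value (adv_job x))) /=.
case: (h) h_gt1 => // h' _; rewrite big_ord_recl /= sumr_const card_ord.
by rewrite mulrDr addrC -mulr_natl; congr (_ + _); ring.
Qed.

(** * Growth and timing of chains and fillers *)

Lemma growth_gt1 : 1 < growth.
Proof.
by rewrite ltr_pdivlMr ?exprn_gt0 // mul1r ltr_wpDr // exprn_ilt1 // ltW.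
Qed.

Lemma growthX_gt0 i : 0 < growth ^+ i.
Proof. by rewrite exprn_gt0 // (lt_trans _ growth_gt1). Qed.

Lemma kappa_ge1 : 1 <= kappa%:R :> R.
Proof. by rewrite ler1n. Qed.

Lemma lag_gt0 : 0 < lag.
Proof. by rewrite divr_gt0 // subr_gt0. Qed.

Lemma total_lag i : (i <= M)%N -> i.+1%:R * lag < 1 - u.
Proof.
move=> i_le; rewrite mulrCA gtr_pMr ?subr_gt0 // ltr_pdivrMr // mul1r.
by rewrite ltr_nat ltnS.
Qed.

Lemma lag_lt1 : lag < 1.
Proof. by have := total_lag (leq0n M); rewrite mul1r; have := u_gt0; lra. Qed.

Lemma chain_startS i : chain_start i.+1 = chain_start i + kappa%:R - lag.
Proof. by rewrite /chain_start -natr1; ring. Qed.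

Lemma chain_start_le i j : (chain_start i <= chain_start j) = (i <= j)%N.
Proof.
rewrite ler_pM2r ?ler_nat //.
by have := kappa_ge1; have := lag_lt1; lra.
Qed.

Lemma chain_start_lt i j : (chain_start i < chain_start j) = (i < j)%N.
Proof. by rewrite !ltNge chain_start_le ltnNge. Qed.

(** A chain before the last is interrupted when its successor arrives, [lag] before it would
    complete; only chain [M] runs to the end. *)
Definition chain_end (i : nat) : R :=
  if (i < M)%N then chain_start i.+1 else chain_start i + kappa%:R.

Lemma chain_end_le i : chain_end i <= chain_start i + kappa%:R.
Proof.
by rewrite /chain_end; case: ifP => // _; rewrite chain_startS; have := lag_gt0; lra.
Qed.

Lemma chain_end_gt i : chain_start i < chain_end i.
Proof.
rewrite /chain_end; case: ifP => _; first by rewrite chain_start_lt.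
by have := kappa_ge1; lra.
Qed.

Lemma chain_end_next i j : (i < j <= M)%N -> chain_end i <= chain_start j.
Proof.
by case/andP=> ij jM; rewrite /chain_end (leq_trans ij jM) chain_start_le.
Qed.

Lemma chain_end_last i : (i <= M)%N -> chain_end i <= chain_end M.
Proof.
rewrite leq_eqVlt => /orP[/eqP->//|iM].
apply: (le_trans (chain_end_next (j := M) _)); first by rewrite iM leqnn.
exact/ltW/chain_end_gt.
Qed.

Lemma filler_start_gt i j : (i <= M)%N -> chain_start i < filler_start i j.
Proof.
move=> iM; rewrite /chain_start /filler_start.
have : 0 <= i%:R * lag by rewrite mulr_ge0 // ltW // lag_gt0.
by have := u_gt0; have : 0 <= j%:R :> R by []; lra.
Qed.

(** The last group of chain [i] starts at [(i + 1) * kappa - 1 + u], while chain [i + 1] starts at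
    [(i + 1) * (kappa - lag)], so the accumulated drift has to stay below [1 - u]. *)
Lemma filler_start_lt i j : (i <= M)%N -> (j < kappa)%N ->
  filler_start i j < chain_end i.
Proof.
move=> iM jk; have := total_lag iM; have := lag_gt0.
have : j%:R + 1 <= kappa%:R :> R by rewrite natr1 ler_nat.
rewrite /chain_end; case: ifP => _; rewrite ?chain_startS /chain_start /filler_start;
  rewrite -natr1; lra.
Qed.

Lemma chain_startM_fillers_end : chain_start M <= fillers_end.
Proof.
rewrite /chain_start /fillers_end -natr1.
have : 0 <= M%:R * lag by rewrite mulr_ge0 // ltW // lag_gt0.
by have := u_gt0; have := kappa_ge1; lra.
Qed.

Lemma adversary_valid : valid adversary kappa.
Proof.
have dem_le m : (0 < m <= n)%N -> (0 < m <= h * n)%N.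
  by case/andP=> -> /leq_trans->//; rewrite leq_pmull // ltnW.
have pos (x : R) : 0 <= x -> 0 < 1 + a * x.
  by move=> x0; rewrite ltr_pwDl // mulr_ge0.
move=> k; rewrite job_ofE; case: (index_of k) => [[i r]|[[i j] r]] /=; split.
- by rewrite mulr_ge0 // subr_ge0 (le_trans (ltW lag_lt1)) // kappa_ge1.
- by apply: dem_le; case: ifP; rewrite ?n_gt0 ?leqnn.
- by rewrite kappa_ge1 lexx.
- by rewrite mulr_gt0 ?growthX_gt0 //; case: ifP; rewrite ?ltr0n.
- by rewrite addr_ge0 ?addr_ge0 ?mulr_ge0 // ltW.
- by apply: dem_le; rewrite n_gt0 leqnn.
- by rewrite lexx kappa_ge1.
- by rewrite !mulr_gt0 ?growthX_gt0 ?exprn_gt0 ?pos ?ltr0n ?divr_ge0.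
Qed.

Lemma adversary_large : (h * n_max adversary <= capacity adversary)%N.
Proof.
rewrite leq_mul2l; apply/orP; right; apply/bigmax_leqP => k _; rewrite job_ofE.
by case: (index_of k) => [[i r]|[[i j] r]] //=; case: ifP.
Qed.

(** * Greedy always runs the newest chain *)

Variable (tie : tie_rule R).
Hypothesis tieP : is_tie_rule tie.
Local Notation f := (linear_priority a).

(** A chain runs only from its release on and without a break, so the index of the running chain
    determines all starting times. *)
Definition running (p : option nat) : {ffun index -> option R} :=
  [ffun k => if chain_of (index_of k) is Some i
             then if p == Some i then Some (chain_start i) else None else None].

(* [p] is the chain running when the decision at time [t] is taken, [i] the chain
   that should run afterwards. *)
Definition decision_ready (i : nat) (p : option nat) (t : R) :=
  p = Some i \/ t = chain_start i /\ (if i is i0.+1 then p = Some i0 else p = None).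

Lemma chainP k i : reflect (exists i' : 'I_M.+1, exists r : 'I_h,
    i' = i :> nat /\ index_of k = inl (i', r)) (k \in chain i).
Proof.
rewrite inE; case E: (index_of k) => [[i' r]|y] /=; last first.
  by constructor; move=> [? [? []]].
apply: (iffP eqP) => [[<-]|[i'' [r' [<- [-> _]]]] //].
by exists i', r.
Qed.

Lemma running_chain p i k : k \in chain i ->
  running p k = if p == Some i then Some (chain_start i) else None.
Proof. by case/chainP=> i' [r [<- kE]]; rewrite ffunE kE. Qed.

(** One formula serves both cases of [decision_ready]: a chain just released has progress 0, and
    then [t - chain_start i] is 0 as well. *)
Lemma progress_chain i p t k : decision_ready i p t -> k \in chain i ->
  progress t (running p) k = (t - chain_start i) / kappa%:R.
Proof.
move=> ready kC; rewrite /progress (running_chain _ kC).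
have -> : len (job_of k) = kappa%:R.
  by have [i' [r [_ kE]]] := chainP _ _ kC; rewrite job_ofE kE.
case: ready => [->|[-> p_prev]]; first by rewrite eqxx.
rewrite ifN ?subrr ?mul0r //.
by case: i p_prev {kC} => [|i0] -> //; rewrite (inj_eq Some_inj) ltn_eqF.
Qed.

Lemma feasible_chain i p t k : (i <= M)%N ->
  chain_start i <= t <= chain_start i + kappa%:R ->
  progress t (running p) k = (t - chain_start i) / kappa%:R -> k \in chain i ->
  k \in feasible_jobs t (running p) finset.set0.
Proof.
move=> iM /andP[t_ge t_le] prog kC; rewrite inE prog finset.in_set0 andbT.
have [i' [r [i'i kE]]] := chainP _ _ kC; rewrite job_ofE kE /= i'i t_ge /=.
rewrite mulrBl mul1r divfK; last by rewrite pnatr_eq0 -lt0n.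
have := chain_startM_fillers_end.
by case: ltnP => [_ _|Mi]; [lra | have -> : i = M by apply/eqP; rewrite eqn_leq iM]; lra.
Qed.

(** These are the only rivals of chain [i]: later jobs are not yet released, and earlier chains have
    tight deadlines, so they survive only if they are running at this very moment. Fillers never
    run, hence are feasible only at their release. *)
Lemma feasible_other i p t k : (i <= M)%N ->
  chain_start i <= t < chain_end i -> decision_ready i p t ->
  k \in feasible_jobs t (running p) finset.set0 -> k \notin chain i ->
  (exists i0 : nat, [/\ i = i0.+1, p = Some i0, t = chain_start i & k \in chain i0]) \/
  (exists j : 'I_kappa, exists (i' : 'I_M.+1) (r : 'I_h), [/\ i' = i :> nat,
      index_of k = inr (i', j, r), t = filler_start i j & progress t (running p) k = 0]).
Proof.
move=> iM /andP[t_ge t_lt] ready; rewrite inE finset.in_set0 andbT => /andP[].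
rewrite /progress ffunE inE job_ofE.
case E: (index_of k) => [[i' r]|[[i' j] r]] /=.
  rewrite (inj_eq Some_inj) => rel dl i'i.
  have i'_lt : (i' < i)%N.
    rewrite ltn_neqAle i'i leqNgt; apply/negP => ii'.
    have i'M : (i' <= M)%N by rewrite -ltnS.
    have := chain_end_next (i := i) (j := i'); rewrite ii' i'M => /(_ isT).
    by rewrite leNgt (le_lt_trans rel).
  left; move: dl; case: eqP => [pE _|_]; last first.
    rewrite subr0 mul1r (leq_trans i'_lt iM).
    have := chain_start_lt i' i; rewrite i'_lt; lra.
  case: ready => [|[tE]]; first by rewrite pE => -[e]; rewrite e eqxx in i'i.
  case: i {iM t_ge t_lt i'i i'_lt} tE => [|i0] tE; rewrite pE // => -[e].
  by exists i0; split; rewrite ?pE ?e //; apply/chainP; exists i', r.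
rewrite subr0 mul1r => rel dl _; right.
have tE : t = filler_start i' j by apply/eqP; rewrite eq_le rel andbT; lra.
have i'M : (i' <= M)%N by rewrite -ltnS.
have i'i : i' = i :> nat.
  apply/eqP; rewrite eqn_leq; apply/andP; split; rewrite leqNgt; apply/negP => ii'.
    have := chain_end_next (i := i) (j := i'); rewrite ii' i'M => /(_ isT).
    have := filler_start_gt j i'M; lra.
  have := chain_end_next (i := i') (j := i); rewrite ii' iM => /(_ isT).
  have := filler_start_lt i'M (ltn_ord j); lra.
by exists j, i', r; rewrite -i'i.
Qed.

(** The factor [c] is [u] for the demand-1 job and 1 for the others; the comparisons below need only
    its range. *)
Lemma density_chain p t k i : k \in chain i ->
  exists2 c, u <= c <= 1 & priority_density f t (running p) k =
    growth ^+ i * c * (1 + a * progress t (running p) k).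
Proof.
case/chainP=> i' [r [<- kE]]; rewrite /priority_density /linear_priority job_ofE kE /=.
case: ifP => _; [exists u | exists 1].
- by rewrite lexx ltW.
- by rewrite divr1.
- by rewrite lexx ltW.
- by rewrite mulrK ?mulr1 // unitfE pnatr_eq0 -lt0n.
Qed.

(** Applies [chosen_dominating] to chain [i]. A rival of demand [n] would raise the total demand to
    [h * n + 1], and its priority value is at most that of a single demand-[n] job of the chain. *)
Lemma chosen_chain i p t : (i <= M)%N ->
  chain_start i <= t < chain_end i -> decision_ready i p t ->
  chosen f tie t (running p) finset.set0 =i chain i.
Proof.
move=> iM t_in ready; have /andP[t_ge t_lt] := t_in.
have kappa0 : 0 < kappa%:R :> R by rewrite ltr0n.
have prog_ge0 : 0 <= (t - chain_start i) / kappa%:R by rewrite divr_ge0 ?subr_ge0.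
have prio_ge1 : 1 <= 1 + a * ((t - chain_start i) / kappa%:R).
  by rewrite lerDl mulr_ge0.
have gi := growthX_gt0.
pose i_ := Ordinal (iM : (i < M.+1)%N); pose big_r := Ordinal h_gt1.
have demC : (\sum_(k in chain i) demand (job_of k) = h.-1 * n + 1)%N.
  exact: (chain_demand i_).
have dem_full : (\sum_(k in chain i) demand (job_of k) + n = (h * n).+1)%N.
  by rewrite demC addn1 addSn -mulSnr prednK // ltnW.
have pv_ge : growth ^+ i * n%:R * (1 + a * ((t - chain_start i) / kappa%:R)) <=
    \sum_(k in chain i) priority_value f t (running p) k.
  pose kb : index := enum_rank (inl (i_, big_r) : adv_index).
  have kbE : index_of kb = inl (i_, big_r) by rewrite index_ofK.
  have kbC : kb \in chain i by apply/chainP; exists i_, big_r.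
  rewrite (bigD1 kb) //= {1}/priority_value (progress_chain ready kbC) job_ofE kbE /=.
  rewrite lerDl sumr_ge0 // => k /andP[kC _].
  rewrite /priority_value (progress_chain ready kC) mulr_ge0 //.
    by have [_ _ _ /ltW] := adversary_valid k.
  exact: le_trans prio_ge1.
have old_prog i0 k : p = Some i0 -> i = i0.+1 -> t = chain_start i -> k \in chain i0 ->
    progress t (running p) k = (t - chain_start i0) / kappa%:R /\
    0 <= (t - chain_start i0) / kappa%:R <= 1.
  move=> pE iE tE kC; split.
    by apply: progress_chain => //; left.
  rewrite tE iE chain_startS ler_pdivrMr // mul1r divr_ge0 ?ler0n //.
    by have := lag_gt0; lra.
  by have := lag_lt1; have := kappa_ge1; lra.
have old_prio x : 0 <= x <= 1 -> 1 <= 1 + a * x <= 1 + a.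
  by case/andP=> x0 x1; rewrite lerDl mulr_ge0 //= lerD2l ler_piMr.
(* The progress term rests on [u * (j + 1) <= j + u <= t - chain_start i]; strictness comes from the
   constant term, as [u < 1]. *)
have filler_coef (j : 'I_kappa) : t = filler_start i j ->
    u * (1 + a * (j.+1%:R / kappa%:R)) <
    1 + a * ((t - chain_start i) / kappa%:R).
  move=> tE; rewrite mulrDr mulr1; apply: ltr_leD => //.
  rewrite mulrCA ler_wpM2l // mulrA ler_pM2r ?invr_gt0 // tE.
  rewrite /filler_start /chain_start -natr1.
  have : 0 <= i%:R * lag by rewrite mulr_ge0 // ltW // lag_gt0.
  have : u * j%:R <= j%:R by rewrite ler_piMl // ltW.
  lra.
apply: (chosen_dominating tieP).
- apply/fintype.subsetP => k kC; apply: (feasible_chain iM) => //.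
    by rewrite t_ge (le_trans (ltW t_lt)) // chain_end_le.
  exact: progress_chain.
- by rewrite -ltnS -dem_full /= -addn1 leq_add2l.
- move=> g x gC xF xC.
  have [cg /andP[ug _] ->] := density_chain p t gC.
  rewrite (progress_chain ready gC).
  case: (feasible_other iM t_in ready xF xC) => [[i0 [iE pE tE xC0]]|].
    have [cx /andP[ux x1] ->] := density_chain p t xC0.
    have [-> /old_prio/andP[o1 o2]] := old_prog _ _ pE iE tE xC0.
    apply: (@le_lt_trans _ _ (growth ^+ i0 * (1 + a))).
      rewrite -mulrA ler_pM2l //.
      apply: (@le_trans _ _ (1 * (1 + a))); last by rewrite mul1r.
      by rewrite ler_pM // ?(le_trans _ o1) // (le_trans _ ux) // ltW.
    apply: (@lt_le_trans _ _ (growth ^+ i * u)); last first.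
      rewrite -mulrA ler_pM2l //; apply: (le_trans ug).
      by rewrite ler_peMr // (le_trans _ ug) // ltW.
    rewrite iE exprSr -mulrA ltr_pM2l // /growth expr2 invfM mulrA divfK ?gt_eqF //.
    by rewrite ltr_pdivlMr // gtr_pMr // ltr_wpDr.
  case=> j [i' [r [i'i xE tE x0]]].
  rewrite /priority_density x0 job_ofE xE /= i'i /linear_priority mulr0 addr0 mulr1.
  rewrite mulfK ?pnatr_eq0 -?lt0n // -!mulrA ltr_pM2l // mulrCA.
  apply: (@lt_le_trans _ _ (u * (1 + a * ((t - chain_start i) / kappa%:R)))).
    by rewrite ltr_pM2l // filler_coef.
  by rewrite ler_wpM2r // (le_trans _ prio_ge1).
- move=> x xF xC; case: (feasible_other iM t_in ready xF xC) => [[i0 [iE pE tE xC0]]|].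
    have [xprog /old_prio/andP[o1 o2]] := old_prog _ _ pE iE tE xC0.
    have [i' [r [i'i0 xE]]] := chainP _ _ xC0.
    (* The demand-1 job of the old chain may still fit, but a demand-[n] job of the same chain is
       denser by the factor [1 / u] and is ranked ahead of it. *)
    case: (eqVneq (val r) 0%N) => r0; [right | left].
      pose kb : index := enum_rank (inl (i', big_r) : adv_index).
      have kbE : index_of kb = inl (i', big_r) by rewrite index_ofK.
      have kbC : kb \in chain i0 by apply/chainP; exists i', big_r.
      have [kbprog _] := old_prog _ _ pE iE tE kbC.
      exists kb; split.
      + apply: (@feasible_chain i0) => //; first by rewrite ltnW // -iE.
        rewrite tE iE chain_start_le leqnSn /= chain_startS.
        by have := lag_gt0; lra.
      + rewrite inE kbE /= i'i0 iE; apply/eqP => -[]/eqP; by rewrite ltn_eqF.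
      rewrite /priority_density kbprog xprog !job_ofE xE kbE /= r0 /= divr1.
      rewrite /linear_priority ltr_pM2r; last exact: lt_le_trans o1.
      by rewrite mulfK ?pnatr_eq0 -?lt0n // gtr_pMr.
    rewrite job_ofE xE /= (negbTE r0) dem_full ltnSn; split=> //.
    apply: le_trans pv_ge; rewrite /priority_value xprog job_ofE xE /= (negbTE r0) i'i0.
    rewrite /linear_priority; apply: (@le_trans _ _ (growth ^+ i0 * n%:R * (1 + a))).
      by rewrite ler_wpM2l // mulr_ge0 // ltW.
    apply: (@le_trans _ _ (growth ^+ i * n%:R)); last first.
      by rewrite ler_peMr // mulr_ge0 // ltW.
    rewrite iE exprSr -!mulrA ler_pM2l // [leLHS]mulrC ler_pM2l ?ltr_wpDr //.
    by rewrite ler_peMl // invf_ge1 ?exprn_gt0 // exprn_ile1 // ltW.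
  case=> j [i' [r [i'i xE tE x0]]]; left.
  rewrite job_ofE xE /= dem_full ltnSn; split=> //; apply: le_trans pv_ge.
  rewrite /priority_value x0 job_ofE xE /= i'i /linear_priority mulr0 addr0 mulr1.
  rewrite -!mulrA ler_pM2l //.
  set c := 1 + a * (j.+1%:R / _); have c_ge0 : 0 <= c.
    by rewrite addr_ge0 // mulr_ge0 // divr_ge0.
  rewrite [leLHS](_ : _ = n%:R * (u * (u * c))); last by ring.
  rewrite ler_pM2l ?ltr0n //; apply: le_trans (ltW (filler_coef j tE)).
  by rewrite ler_piMl ?mulr_ge0 // ltW.
Qed.

Definition adv_invariant (s : state adversary) : Prop :=
  (exists i, [/\ (i <= M)%N, chain_start i <= now s < chain_end i,
     since s = running (Some i) & finished s = finset.set0]) \/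
  [/\ chain_end M <= now s, since s = running None & finished s = chain M].

Lemma decide_chain i p t : (i <= M)%N ->
  chain_start i <= t < chain_end i -> decision_ready i p t ->
  adv_invariant (decide f tie t (running p) finset.set0).
Proof.
move=> iM t_in ready; left; exists i; split=> //.
apply/ffunP => k; rewrite since_decide (chosen_chain iM t_in ready).
case: ifPn => kC; last first.
  rewrite ffunE; case E: (index_of k) => [[i' r]|//] /=; rewrite ifN //.
  by apply: contra kC => /eqP[->]; apply/chainP; exists i', r.
rewrite !(running_chain _ kC) eqxx; case: ready => [->|[-> p_prev]].
  by rewrite eqxx.
by case: ifP.
Qed.

Lemma release_lt_end k : release (@job_of R adversary k) < chain_end M.
Proof.
rewrite job_ofE; case: (index_of k) => [[i r]|[[i j] r]] /=.
  by apply: lt_le_trans (chain_end_gt i) (chain_end_last (leq_ord i)).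
by apply: lt_le_trans (filler_start_lt _ _) (chain_end_last _); rewrite ?leq_ord.
Qed.

(** Chain [M] is finished, and every other job has a tight deadline that has passed by then. *)
Lemma nothing_feasible_at_end :
  feasible_jobs (chain_end M) (running (Some M)) (chain M) = finset.set0.
Proof.
apply/setP => k; rewrite finset.in_set0; apply/negP; rewrite inE => /and3P[_].
rewrite /progress ffunE [k \in chain M]inE.
have := release_lt_end k; rewrite job_ofE.
case: (index_of k) => [[i r]|[[i j] r]] /= rel dl.
  rewrite eq_sym (inj_eq Some_inj) => iM; rewrite (inj_eq Some_inj) in dl.
  have i_lt : (i < M)%N by rewrite ltn_neqAle eq_sym iM -ltnS /=.
  by move: dl; rewrite (negbTE iM) i_lt; lra.
by move: dl; rewrite subr0 mul1r; lra.
Qed.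

(** The next critical time never jumps past [chain_end i]. Before it, chain [i] goes on; at it,
    chain [i + 1] takes over if [i < M], and otherwise chain [M] completes and nothing is left. *)
Lemma step_invariant s : adv_invariant s -> adv_invariant (step f tie s).
Proof.
move=> inv; rewrite /step; case E: (next_critical s) => [t|//].
have [rel_le end_le t_mem] := next_critical_some E.
have lenC i k : k \in chain i -> len (job_of k) = kappa%:R.
  by case/chainP=> i' [r [_ kE]]; rewrite job_ofE kE.
have since_chain i k v : since s = running (Some i) -> since s k = Some v ->
    k \in chain i /\ v = chain_start i.
  move=> ->; rewrite ffunE; case kE: (index_of k) => [[i' r]|//] /=.
  case: eqP => // -[e] [<-]; split; rewrite ?e //.
  by apply/chainP; exists i', r.
have h_gt0 : (0 < h)%N by rewrite ltnW.
case: inv => [[i [iM /andP[now_ge now_lt] sinceE finE]]|[now_ge sinceE _]]; last first.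
  case: t_mem => [[k [_ k_new]]|[k [v [sk _]]]].
    by have := lt_le_trans (release_lt_end k) now_ge; rewrite ltNge ltW.
  by move: sk; rewrite sinceE ffunE; case: (chain_of _).
have now_t : now s < t.
  case: t_mem => [[k [-> //]]|[k [v [sk ->]]]].
  have [kC ->] := since_chain _ _ _ sinceE sk.
  by rewrite (lenC _ _ kC) (lt_le_trans now_lt) // chain_end_le.
have t_ge := le_trans now_ge (ltW now_t).
(* The witnessing event is the release of chain [i + 1], or the completion of chain [M] when
   [i = M]. *)
have t_le : t <= chain_end i.
  rewrite /chain_end; case: ifPn => iM'.
    pose k : index := enum_rank (inl (Ordinal (iM' : (i.+1 < M.+1)%N),
                                      Ordinal h_gt0) : adv_index).
    have kE : release (job_of k) = chain_start i.+1.
      by rewrite job_ofE index_ofK.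
    rewrite -kE; apply: rel_le; rewrite kE.
    by move: now_lt; rewrite /chain_end iM'.
  pose k : index := enum_rank (inl (Ordinal (iM : (i < M.+1)%N),
                                    Ordinal h_gt0) : adv_index).
  have kC : k \in chain i by rewrite inE index_ofK.
  rewrite -(lenC _ _ kC); apply: end_le.
  by rewrite sinceE (running_chain _ kC) eqxx.
have not_done : t < chain_start i + kappa%:R -> finished_at t s = finset.set0.
  move=> t_lt; rewrite /finished_at finE finset.set0U; apply/setP => k.
  rewrite inE finset.in_set0; case sk: (since s k) => [v|//].
  have [kC ->] := since_chain _ _ _ sinceE sk.
  by rewrite (lenC _ _ kC) leNgt t_lt.
move: t_le; rewrite le_eqVlt => /orP[/eqP tE|t_lt]; last first.
  rewrite sinceE not_done; last exact: lt_le_trans (chain_end_le _).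
  by apply: (@decide_chain i) => //; [rewrite t_ge | left].
case: (ltnP i M) => iM'.
  have tE' : t = chain_start i.+1 by rewrite tE /chain_end iM'.
  rewrite sinceE not_done; last first.
    by rewrite tE' chain_startS; have := lag_gt0; lra.
  apply: (@decide_chain i.+1) => //; last by right.
  by rewrite tE' lexx chain_end_gt.
have {iM iM'} iE : i = M by apply/eqP; rewrite eqn_leq iM.
rewrite iE in tE sinceE.
have finM : finished_at t s = chain M.
  rewrite /finished_at finE finset.set0U; apply/setP => k; rewrite inE.
  case: (boolP (k \in chain M)) => kC.
    rewrite sinceE (running_chain _ kC) eqxx (lenC _ _ kC) tE.
    by rewrite /chain_end ltnn lexx.
  case sk: (since s k) => [v|//].
  by have [] := since_chain _ _ _ sinceE sk; rewrite (negbTE kC).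
rewrite finM sinceE tE; right; split=> //=.
apply/ffunP => k; rewrite ffunE [RHS]ffunE.
have -> : chosen f tie (chain_end M) (running (Some M)) (chain M) = [::].
  rewrite /chosen; suff -> : ranking f tie (chain_end M) (running (Some M)) (chain M) = [::].
    by case: (fitting _ _ _ _ _).
  by rewrite /ranking nothing_feasible_at_end enum_set0.
by rewrite in_nil; case: (chain_of _).
Qed.

(** As an upper bound this requires no count of the steps: in every state satisfying the invariant,
    the finished set is empty or chain [M]. *)
Lemma greedy_welfare_le :
  greedy_welfare f tie adversary <= growth ^+ M * (h.-1%:R * n%:R + u).
Proof.
have inv : adv_invariant (greedy_run f tie adversary).
  rewrite /greedy_run; elim: (2 * _)%N => [|m IHm]; last exact: step_invariant.
  have -> : [ffun=> None] = running None.
    by apply/ffunP => k; rewrite !ffunE; case: (chain_of _).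
  have start0 : chain_start 0 = 0 by rewrite /chain_start mul0r.
  apply: (@decide_chain 0) => //; last by right.
  by rewrite start0 lexx -start0 chain_end_gt.
rewrite /greedy_welfare; case: inv => [[i [_ _ _ ->]]|[_ _ ->]].
  rewrite /total_value big_set0 mulr_ge0 ?addr_ge0 ?mulr_ge0 //; apply: ltW => //.
  exact: growthX_gt0.
by rewrite (chain_total_value ord_max).
Qed.

(** * The offline schedule: all fillers, then chain M *)

Definition kept (x : adv_index) : bool :=
  if x is inl (i, _) then val i == M else true.

Definition opt_start (x : adv_index) : R :=
  if x is inr (i, j, _) then filler_start i j else fillers_end.

Lemma big_kept (V : Type) (idx : V) (op : Monoid.com_law idx)
    (F : adv_index -> V) (P : pred adv_index) :
  \big[op/idx]_(x | kept x && P x) F x =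
  op (\big[op/idx]_(r < h | P (inl (ord_max, r))) F (inl (ord_max, r)))
     (\big[op/idx]_(y : 'I_M.+1 * 'I_kappa)
        \big[op/idx]_(r < h | P (inr (y, r))) F (inr (y, r))).
Proof.
rewrite big_sumType /=; congr (op _ _).
  rewrite (eq_bigl (fun x : 'I_M.+1 * 'I_h => (x.1 == ord_max) && P (inl (x.1, x.2))));
    last by case.
  rewrite (eq_bigr (fun x : 'I_M.+1 * 'I_h => F (inl (x.1, x.2)))); last by case.
  rewrite -(pair_big_dep (pred1 ord_max) (fun i r => P (inl (i, r)))
    (fun i r => F (inl (i, r)))) /=.
  by rewrite big_pred1_eq.
rewrite pair_big_dep /=; apply: eq_big; first by case.
by case.
Qed.

Lemma sum_fillers_coef :
  \sum_(j < kappa) (1 + a * (j.+1%:R / kappa%:R)) =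
  kappa%:R + a * (kappa%:R + 1) / 2.
Proof.
have kappa0 : kappa%:R != 0 :> R by rewrite pnatr_eq0 -lt0n.
(* The range is decoupled from the [kappa] in the summand to allow induction. *)
have : forall m : nat, \sum_(j < m) (1 + a * (j.+1%:R / kappa%:R)) =
    m%:R + a * (m%:R * (m%:R + 1)) / (2 * kappa%:R).
  elim=> [|m IHm]; first by rewrite big_ord0; field.
  by rewrite big_ord_recr /= IHm -!natr1; field.
by move=> ->; field.
Qed.

(** Filler groups fill consecutive unit slots, numbered [i * kappa + j] and shifted by [u]; division
    with remainder by [kappa] recovers [i] and [j]. *)
Lemma filler_slot_inj (y y' : 'I_M.+1 * 'I_kappa) t :
  filler_start y.1 y.2 <= t < filler_start y.1 y.2 + 1 ->
  filler_start y'.1 y'.2 <= t < filler_start y'.1 y'.2 + 1 -> y = y'.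
Proof.
have slotE (z : 'I_M.+1 * 'I_kappa) :
    filler_start z.1 z.2 = (z.1 * kappa + z.2)%:R + u.
  by rewrite natrD natrM.
have slot_le (z z' : 'I_M.+1 * 'I_kappa) :
    filler_start z.1 z.2 <= t -> t < filler_start z'.1 z'.2 + 1 ->
    (z.1 * kappa + z.2 <= z'.1 * kappa + z'.2)%N.
  rewrite !slotE => z_le t_lt; rewrite -ltnS -(ltr_nat R) -natr1.
  by move: (le_lt_trans z_le t_lt); lra.
move=> /andP[y1 y2] /andP[y'1 y'2].
have /eqP slots : (y.1 * kappa + y.2 == y'.1 * kappa + y'.2)%N.
  by rewrite eqn_leq !slot_le.
case: y y' slots {y1 y2 y'1 y'2 slot_le} => [i j] [i' j'] /= slots.
have jj' : j = j'.
  apply: val_inj => /=.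
  by rewrite -(modn_small (ltn_ord j)) -(modnMDl i) slots modnMDl modn_small.
have /eqP ii' : (i == i').
  by rewrite -val_eqE /= -(eqn_pmul2r kappa_gt0); apply/eqP/(@addIn j); rewrite slots jj'.
by rewrite ii' jj'.
Qed.

Lemma OPT_adversary_ge :
  growth ^+ M * (h.-1%:R * n%:R + u) +
  h%:R * n%:R * u ^+ 2 * (kappa%:R + a * (kappa%:R + 1) / 2) *
    \sum_(i < M.+1) growth ^+ i <= OPT adversary.
Proof.
pose S : {set index} := [set k | kept (index_of k)]%SET.
have in_S k : (k \in S) = kept (index_of k) by rewrite inE.
have -> : growth ^+ M * (h.-1%:R * n%:R + u) +
    h%:R * n%:R * u ^+ 2 * (kappa%:R + a * (kappa%:R + 1) / 2) *
    \sum_(i < M.+1) growth ^+ i = total_value S.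
  rewrite /total_value (eq_bigl _ _ in_S).
  rewrite (big_index _ kept (fun x => value (adv_job x))).
  rewrite (eq_bigl (fun x => kept x && true)); last by move=> x; rewrite andbT.
  rewrite big_kept; congr (_ + _).
    rewrite -(chain_total_value ord_max) /total_value.
    by rewrite (big_chain _ (fun x => value (adv_job x))).
  rewrite (eq_bigr (fun y : 'I_M.+1 * 'I_kappa =>
    growth ^+ y.1 * (h%:R * n%:R * u ^+ 2 * (1 + a * (y.2.+1%:R / kappa%:R))))); last first.
    by move=> [i j] _ /=; rewrite sumr_const card_ord -mulr_natl; ring.
  rewrite -(pair_bigA _ (fun (i : 'I_M.+1) (j : 'I_kappa) =>
    growth ^+ i * (h%:R * n%:R * u ^+ 2 * (1 + a * (j.+1%:R / kappa%:R))))) /=.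
  under [RHS]eq_bigr do rewrite -mulr_sumr -mulr_sumr sum_fillers_coef.
  by rewrite -mulr_suml mulrC.
apply: (OPT_ge_schedule (start := fun k => opt_start (index_of k)) adversary_valid).
  move=> k; rewrite in_S job_ofE; case: (index_of k) => [[i r]|[[i j] r]] /=.
    by move=> /eqP->; rewrite ltnn chain_startM_fillers_end.
  by rewrite lexx.
move=> t; pose active x := (opt_start x <= t < opt_start x + len (adv_job x))%R.
rewrite (eq_bigl (fun k => kept (index_of k) && active (index_of k))); last first.
  by move=> k; rewrite in_S.
rewrite (big_index _ (fun x => kept x && active x) (fun x => demand (adv_job x))).
rewrite (big_kept _ (fun x => demand (adv_job x)) active).
pose load y := (\sum_(r < h | active (inr (y, r))) demand (adv_job (inr (y, r))))%N.
rewrite -[leqLHS]/(\sum_(r < h | active (inl (ord_max, r)))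
  demand (adv_job (inl (ord_max, r))) + \sum_y load y)%N.
(* Before [fillers_end] at most one group is live, and its [h] jobs use the capacity [h * n]
   exactly; afterwards only chain [M] runs, which fits since [1 <= n]. *)
have [t_lt|t_ge] := ltP t fillers_end.
  rewrite [X in (X + _)%N]big_pred0 ?add0n => [|r]; last by rewrite /active /= leNgt t_lt.
  pose live (y : 'I_M.+1 * 'I_kappa) := (filler_start y.1 y.2 <= t < filler_start y.1 y.2 + 1)%R.
  have load0 y : ~~ live y -> load y = 0%N.
    by case: y => i j dead; rewrite /load big_pred0 // => r; apply/negbTE.
  case: (pickP live) => [y0 y0_live|dead]; last first.
    by rewrite big1 // => y _; apply: load0; rewrite dead.
  rewrite (bigD1 y0) //= big1 ?addn0 => [|y y_neq]; last first.
    apply: load0; apply: contra y_neq => y_live; apply/eqP.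
    exact: filler_slot_inj y_live y0_live.
  apply: (@leq_trans (\sum_(r < h) n)%N); last by rewrite sum_nat_const card_ord.
  rewrite /load big_mkcond leq_sum // => r _; case: ifP => // _.
  by case: (y0).
rewrite [X in (_ + X)%N]big1 ?addn0 => [|[i j] _]; last first.
  apply: big_pred0 => r; apply/negbTE; rewrite negb_and orbC -leNgt /=.
  apply/orP; left; apply: le_trans t_ge; rewrite /filler_start /fillers_end -natr1.
  have : j%:R + 1 <= kappa%:R :> R by rewrite natr1 ler_nat.
  have : i%:R * kappa%:R <= M%:R * kappa%:R :> R.
    by rewrite -!natrM ler_nat leq_mul2r leq_ord orbT.
  lra.
have sizes := chain_demand ord_max; rewrite (big_chain _ (fun x => demand (adv_job x))) /= in sizes.
apply: (@leq_trans (\sum_(r < h) if val r == 0 then 1 else n)%N).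
  by rewrite big_mkcond leq_sum // => r _; case: ifP.
have -> : capacity adversary = (h.-1 * n + n)%N.
  by rewrite /= -mulSnr prednK // ltnW.
by rewrite sizes leq_add2l.
Qed.

End Adversary.

(** * Passing to the limit *)

Lemma greedy_welfare_ge0 (R : realType) (f : R -> R) (tie : tie_rule R)
    (I : instance R) (kappa : nat) :
  valid I kappa -> 0 <= greedy_welfare f tie I.
Proof. by move=> Ivalid; apply: sumr_ge0 => k _; have [_ _ _ /ltW] := Ivalid k. Qed.

(** Replaces all three passages to the limit: divide by [m] and let it grow. *)
Lemma le_of_affine_bound (R : realType) (x y z : R) :
  (forall m : nat, (0 < m)%N -> x * m%:R <= y * m%:R + z) -> x <= y.
Proof.
move=> bound; rewrite leNgt; apply/negP => yx.
have d_gt0 : 0 < x - y by rewrite subr_gt0.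
pose m := (Num.trunc (`|z| / (x - y))).+1.
have m_gt : `|z| / (x - y) < m%:R by apply: truncnS_gt.
have := bound m isT; rewrite leNgt => /negP[].
rewrite -ltrBrDl -mulrBl mulrC (le_lt_trans (ler_norm z)) //.
by rewrite -ltr_pdivrMr.
Qed.

Lemma bernoulli (R : realType) (x : R) (m : nat) : 1 <= x ->
  1 + (x - 1) * m%:R <= x ^+ m.
Proof.
move=> x1; elim: m => [|m IHm]; first by rewrite mulr0 addr0.
rewrite exprS; apply: (@le_trans _ _ (x * (1 + (x - 1) * m%:R))).
  have : 0 <= (x - 1) * (x - 1) * m%:R by rewrite !mulr_ge0 ?subr_ge0.
  by rewrite -natr1; lra.
by rewrite ler_wpM2l // (le_trans ler01).
Qed.

Section LowerBound.
Variables (R : realType) (h kappa : nat) (a c : R) (tie : tie_rule R).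
Hypotheses (h_gt1 : (1 < h)%N) (kappa_gt0 : (0 < kappa)%N) (a_ge0 : 0 <= a).
Hypothesis tieP : is_tie_rule tie.
Hypothesis c_comp : competitive (@large_capacity R h kappa)
  (@greedy_welfare R (linear_priority a) tie) c.

Local Notation K := (kappa%:R + a * (kappa%:R + 1) / 2 : R).

Let K_gt0 : 0 < K.
Proof. by rewrite ltr_wpDr ?ltr0n // !mulr_ge0 // addr_ge0. Qed.

Let h_gt0 : 0 < h%:R :> R.
Proof. by rewrite ltr0n ltnW. Qed.

Lemma competitive_ge1 : 1 <= c /\ forall (M n : nat) (u : R), (0 < n)%N -> 0 < u < 1 ->
  h%:R * n%:R * u ^+ 2 * K * \sum_(i < M.+1) growth a u ^+ i <=
  (c - 1) * (growth a u ^+ M * (h.-1%:R * n%:R + u)).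
Proof.
suff main M n u : (0 < n)%N -> 0 < u < 1 -> 1 <= c /\
    h%:R * n%:R * u ^+ 2 * K * \sum_(i < M.+1) growth a u ^+ i <=
    (c - 1) * (growth a u ^+ M * (h.-1%:R * n%:R + u)).
  split=> [|M n u n_gt0 u_in]; last by have [] := main M n u n_gt0 u_in.
  have [|//] := main 0%N 1%N (1 / 2) isT.
  by rewrite divr_gt0 //= ltr_pdivrMr // mul1r ltr1n.
move=> n_gt0 /andP[u_gt0 u_lt1].
have Ivalid := @adversary_valid _ _ _ M _ _ _ h_gt1 kappa_gt0 n_gt0 a_ge0 u_gt0 u_lt1.
have Ilarge := @adversary_large R h kappa M n a u n_gt0.
have OPT_ge := @OPT_adversary_ge _ _ _ M _ _ _ h_gt1 kappa_gt0 n_gt0 a_ge0 u_gt0 u_lt1.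
have W_le := @greedy_welfare_le _ _ _ M _ _ _ h_gt1 kappa_gt0 n_gt0 a_ge0 u_gt0 u_lt1 _ tieP.
have W_ge0 := greedy_welfare_ge0 (linear_priority a) tie Ivalid.
have gX := growthX_gt0 a_ge0 u_gt0 u_lt1.
have := c_comp (conj Ivalid Ilarge).
set W := greedy_welfare _ _ _ in W_le W_ge0 *; set F := _ * \sum_(i < _) _ in OPT_ge *.
set G := growth a u ^+ M * _ in OPT_ge W_le *.
move=> /negP; rewrite -leNgt => /(le_trans OPT_ge) GF_le.
have G_gt0 : 0 < G by rewrite mulr_gt0 // ltr_wpDl // mulr_ge0.
have F_gt0 : 0 < F.
  rewrite !mulr_gt0 ?ltr0n ?exprn_gt0 ?(ltnW h_gt1) //.
  by rewrite big_ord_recl expr0 ltr_wpDr // sumr_ge0 // => i _; rewrite ltW.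
(* The sign of [c] is what allows replacing the welfare [W] by its upper bound [G] in
   [OPT <= c * W]. *)
have c_gt0 : 0 < c.
  rewrite ltNge; apply/negP => c_le0.
  by have := mulr_le0_ge0 c_le0 W_ge0; lra.
have : c * W <= c * G by rewrite ler_pM2l.
have F_le : G + F <= c * G by apply: le_trans GF_le _; rewrite ler_pM2l.
move=> _; split; last by rewrite mulrBl mul1r; lra.
by rewrite -(ler_pM2r G_gt0) mul1r; lra.
Qed.

Lemma competitive_ge_limit_n (M : nat) (u : R) : 0 < u < 1 ->
  h%:R * u ^+ 2 * K * \sum_(i < M.+1) growth a u ^+ i <=
  (c - 1) * h.-1%:R * growth a u ^+ M.
Proof.
move=> u_in; have [_ bound] := competitive_ge1.
apply: (@le_of_affine_bound _ _ _ ((c - 1) * growth a u ^+ M * u)) => n n_gt0.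
by have := bound M n u n_gt0 u_in; lra.
Qed.

Lemma competitive_ge_limit_M (u : R) : 0 < u < 1 ->
  h%:R * K * (1 + a) * u ^+ 2 <= (c - 1) * h.-1%:R * (1 + a - u ^+ 2).
Proof.
move=> u_in; have /andP[u_gt0 u_lt1] := u_in.
have u2_gt0 : 0 < u ^+ 2 by rewrite exprn_gt0.
have g_gt1 := growth_gt1 a_ge0 u_gt0 u_lt1.
set g := growth a u in g_gt1.
have g1_gt0 : 0 < g - 1 by rewrite subr_gt0.
have gE : g * u ^+ 2 = 1 + a by rewrite divfK // gt_eqF.
set D := h%:R * u ^+ 2 * K; set P := (c - 1) * h.-1%:R.
have D_gt0 : 0 < D by rewrite !mulr_gt0.
have bound m : D * (g ^+ m * g - 1) <= P * (g - 1) * g ^+ m.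
  rewrite -exprSr subrX1 mulrCA [leRHS](_ : _ = (g - 1) * (P * g ^+ m)); last by ring.
  by rewrite ler_pM2l //; apply: competitive_ge_limit_n.
suff Dg_le : D * g <= P * (g - 1).
  by move: Dg_le; rewrite -(ler_pM2r u2_gt0) /D; nra.
(* If the difference [d = D * g - P * (g - 1)] were positive, [bound] would give [d * g ^+ m <= D]
   for all [m], whereas [g ^+ m] grows at least linearly by Bernoulli. *)
rewrite leNgt; apply/negP => lt_Dg.
have d_gt0 : 0 < D * g - P * (g - 1) by rewrite subr_gt0.
suff : (D * g - P * (g - 1)) * (g - 1) <= 0 by rewrite leNgt mulr_gt0.
apply: (@le_of_affine_bound _ _ _ D) => m _; rewrite mul0r add0r.
have := bernoulli m (ltW g_gt1); rewrite -(ler_pM2l d_gt0) => bern.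
by have := bound m; lra.
Qed.

Lemma competitive_ge_limit_u : h%:R * K * (1 + a) <= (c - 1) * h.-1%:R * a.
Proof.
have [c_ge1 _] := competitive_ge1.
set P := (c - 1) * _; set Q := h%:R * K * (1 + a).
have P_ge0 : 0 <= P by rewrite mulr_ge0 ?subr_ge0.
have Q_ge0 : 0 <= Q by apply: mulr_ge0; [exact/mulr_ge0/ltW | exact: addr_ge0].
suff : Q + P <= P * (1 + a) by lra.
apply: (@le_of_affine_bound _ _ _ (P * (1 + a) + (Q + P))) => m m_gt0.
have m1 : 0 < m%:R + 1 :> R by rewrite ltr_wpDl.
(* This [u] tends to 1, and [u ^+ 2 >= (m - 1) / (m + 1)] makes the bound affine in [m] after
   clearing the denominator. *)
pose u : R := m%:R / (m%:R + 1).
have u_in : 0 < u < 1.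
  by rewrite divr_gt0 ?ltr0n //= ltr_pdivrMr // mul1r ltrDl.
have := competitive_ge_limit_M u_in; rewrite -/P -/Q => bound.
have u2 : (m%:R - 1) / (m%:R + 1) <= u ^+ 2.
  rewrite /u expr2 mulf_div ler_pdivrMr // mulrAC ler_pdivlMr ?mulr_gt0 //.
  by have : 0 <= m%:R :> R by []; nra.
have : (Q + P) * ((m%:R - 1) / (m%:R + 1)) <= P * (1 + a).
  apply: (@le_trans _ _ ((Q + P) * u ^+ 2)); last by lra.
  by rewrite ler_wpM2l // addr_ge0.
by rewrite mulrA ler_pdivrMr //; lra.
Qed.

End LowerBound.

Theorem theorem3p12 (R : realType) (h kappa : nat) (a : R) (tie : tie_rule R)
    (h_ge2 : (2 <= h)%N) (kappa_ge1 : (1 <= kappa)%N) (a_ge0 : 0 <= a)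
    (tieP : is_tie_rule tie) :
  ((h%:R / (h%:R - 1) *
      (Num.sqrt (2 * kappa%:R * (kappa%:R + 1)) + 3 / 2 * kappa%:R + 1 / 2)
    + 1)%:E
   <= competitive_ratio (@large_capacity R h kappa)
        (@greedy_welfare R (linear_priority a) tie))%E.
Proof.
apply/ereal_infP => _ [c c_comp <-]; rewrite lee_fin.
have main := competitive_ge_limit_u h_ge2 kappa_ge1 a_ge0 tieP c_comp.
have k_gt0 : 0 < kappa%:R :> R by rewrite ltr0n.
have h_gt0 : 0 < h%:R :> R by rewrite ltr0n ltnW.
have hE : h.-1%:R = h%:R - 1 :> R by rewrite -subn1 natrB // ltnW.
have h1_gt0 : 0 < h%:R - 1 :> R by rewrite subr_gt0 ltr1n.
rewrite hE in main.
(* For [a = 0] the bound [main] would read [h * kappa <= 0], so no [c] is competitive. *)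
have a_gt0 : 0 < a.
  rewrite lt_neqAle a_ge0 andbT eq_sym; apply/eqP => a0; move: main.
  rewrite a0 !(mulr0, mul0r, addr0, mulr1) leNgt => /negP[]; exact: mulr_gt0.
set s := Num.sqrt _.
have s2 : s ^+ 2 = 2 * kappa%:R * (kappa%:R + 1).
  by rewrite sqr_sqrtr // !mulr_ge0 // addr_ge0.
(* AM-GM, obtained by expanding the square of [2 * kappa - a * s] and dividing by [4 * kappa]. *)
have amgm : a * s <= kappa%:R + a ^+ 2 * (kappa%:R + 1) / 2.
  have k2 : 0 < 2 * kappa%:R :> R by rewrite mulr_gt0.
  rewrite -(ler_pM2l k2).
  have : 0 <= (2 * kappa%:R - a * s) ^+ 2 by rewrite sqr_ge0.
  have : a ^+ 2 * s ^+ 2 = a ^+ 2 * (2 * kappa%:R * (kappa%:R + 1)) by rewrite s2.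
  by lra.
rewrite -lerBrDr mulrAC ler_pdivrMr //.
rewrite -(ler_pM2r a_gt0); apply: le_trans main.
(* The product of [kappa + a * (kappa + 1) / 2] and [1 + a] is [a * (3 / 2 * kappa + 1 / 2)] plus
   the right-hand side of [amgm]. *)
rewrite -!mulrA ler_pM2l // mulrC; lra.
Qed.
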